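(* Let $n\ge1$, $\mathbf J=\{1,\dots,n\}$, and let $\mathrm{Karp}_n\subset\prod_{\mathfrak b}\overline{\Xi[\mathbf J;\mathfrak b]}$ be the Karpelevich polyhedron. Then $\mathrm{Karp}_n$ is the disjoint union $$\mathrm{Karp}_n=\bigsqcup_{\mathfrak A}\mathrm{Str}(\mathfrak A)$$ over all leveled tree-partitions $\mathfrak A$ of $\mathbf J$; that is, the canonical maps $\iota_{\mathfrak A}:\mathrm{Str}(\mathfrak A)\to\prod_{\mathfrak b}\overline{\Xi[\mathbf J;\mathfrak b]}$ described in the context are injective, have pairwise disjoint images, and the union of their images is $\mathrm{Karp}_n$.
   Context: For a finite nonempty set $I$, $\Xi(I)$ is the vector space of functions $I\to\mathbb R$ modulo constant functions; $\Xi_n:=\Xi(\mathbf J)$. For a partition $\mathfrak a$ of $I$, $\Xi[I;\mathfrak a]$ is the space of functions $I\to\mathbb R$ modulo functions that are constant on each element of $\mathfrak a$; there is a natural projection $\Xi(I)\to\Xi[I;\mathfrak a]$, and if $\mathfrak b$ is a refinement of $\mathfrak a$ (possibly equal to it), a natural projection $\Xi[I;\mathfrak a]\to\Xi[I;\mathfrak b]$. For a finite-dimensional real vector space $V$, $\partial V$ is the set of rays $\{\lambda v:\lambda>0\}$, $v\neq 0$, and $\overline V=V\sqcup\partial V$ is the compactification of $V$ by this sphere at infinity ($\partial V=\varnothing$ if $V=0$). $\partial\Xi[I;\mathfrak a]^{\mathrm{gen}}\subset\partial\Xi[I;\mathfrak a]$ is the set of rays of classes of functions $f$ such that $f(a)\ne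 f(b)$ whenever $a\ne b$ lie in the same element of $\mathfrak a$. The Karpelevich polyhedron $\mathrm{Karp}_n$ is the closure of the image of the diagonal map $\Xi_n\to\prod_{\mathfrak b}\Xi[\mathbf J;\mathfrak b]\subset\prod_{\mathfrak b}\overline{\Xi[\mathbf J;\mathfrak b]}$, the product being over all partitions $\mathfrak b$ of $\mathbf J$. A leveled tree-partition $\mathfrak A$ of $\mathbf J$ is a sequence of partitions $\mathfrak a_0,\mathfrak a_1,\dots,\mathfrak a_\tau$ ($\tau\ge0$) of $\mathbf J$, where $\mathfrak a_0$ has the single element $\mathbf J$, and each $\mathfrak a_{j+1}$ is a refinement of $\mathfrak a_j$ with $\mathfrak a_{j+1}\ne\mathfrak a_j$. For $j<\tau$, $\mathfrak a_j/\mathfrak a_{j+1}$ denotes the partition of the quotient set $\mathbf J/\mathfrak a_{j+1}$ induced by $\mathfrak a_j$. Put $W_j[\mathfrak A]=\partial\Xi[\mathbf J/\mathfrak a_{j+1};\mathfrak a_j/\mathfrak a_{j+1}]^{\mathrm{gen}}$ for $j<\tau$, $W_\tau[\mathfrak A]=\Xi[\mathbf J;\mathfrak a_\tau]$, and $\mathrm{Str}(\mathfrak A)=\prod_{j=0}^\tau W_j[\mathfrak A]$. The map $\iota_{\mathfrak A}$: for $u=(u_j)\in\mathrm{Str}(\mathfrak A)$ and a partition $\mathfrak b$ of $\mathbf J$, let $j$ be maximal such that $\mathfrak b$ is a refinement of $\mathfrak a_j$ (possibly equal). If $j=\tau$, the $\mathfrak b$-component of $\iota_{\mathfrak A}(u)$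 is the image of $u_\tau$ under $\Xi[\mathbf J;\mathfrak a_\tau]\to\Xi[\mathbf J;\mathfrak b]$. If $j<\tau$, it is the image of $u_j$ under $\partial\Xi[\mathbf J/\mathfrak a_{j+1};\mathfrak a_j/\mathfrak a_{j+1}]^{\mathrm{gen}}\to\partial\Xi[\mathbf J;\mathfrak a_j]$ (induced by pulling functions back along $\mathbf J\to\mathbf J/\mathfrak a_{j+1}$), followed by the map to $\partial\Xi[\mathbf J;\mathfrak b]$ induced by $\Xi[\mathbf J;\mathfrak a_j]\to\Xi[\mathbf J;\mathfrak b]$ (defined on this ray, since the function is nonconstant on some element of $\mathfrak b$). *)

(* Defs.v *)
From HB Require Import structures.
From mathcomp Require Import all_boot all_order all_algebra generic_quotient.
From mathcomp Require Import ring_quotient.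
From mathcomp Require Import all_classical all_reals all_analysis.

Set Implicit Arguments.
Unset Strict Implicit.
Unset Printing Implicit Defensive.

Import Order.TTheory GRing.Theory Num.Theory.
Import numFieldNormedType.Exports.
Import ArrowAsProduct.

Local Open Scope classical_set_scope.
Local Open Scope ring_scope.
Local Open Scope quotient_scope.

(** * Compactification of a vector space by the sphere at infinity *)

Section Compactification.
Context {R : realType}.

Definition open_ray {V : lmodType R} (v : V) : set V :=
  [set t *: v | t in [set t : R | 0 < t]].

Definition is_ray {V : lmodType R} (r : set V) : Prop :=
  exists2 v, v != 0 & r = open_ray v.

Definition ray (V : lmodType R) : Type := {r : set V | is_ray r}.

Variant compactification (V : lmodType R) : Type :=
  | Fin of V
  | Inf of ray V.

Arguments Fin {V} _.
Arguments Inf {V} _.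

HB.instance Definition _ (V : lmodType R) := gen_eqMixin (compactification V).
HB.instance Definition _ (V : lmodType R) :=
  gen_choiceMixin (compactification V).

Section Topology.
Variable V : preTopologicalLmodType R.

(* For V of finite dimension this is the topology of the closed ball: a basis
   of neighbourhoods of the ray of v is given, for O a neighbourhood of v and
   M > 0, by the points t *: w and the rays of w, where w is in O, t > M. *)
Definition compactification_open (U : set (compactification V)) : Prop :=
  open [set v | U (Fin v)] /\
  forall (r : ray V) (v : V), U (Inf r) -> sval r v ->
    (\forall w \near v & t \near +oo, U (Fin (t *: w))) /\
    (\forall w \near v, forall s : ray V, sval s w -> U (Inf s)).

Lemma compactification_openT : compactification_open setT.
Proof.
split=> [|r v _ _]; first exact: openT.
by split; exact: filterE.
Qed.

Lemma compactification_openI (A B : set (compactification V)) :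
  compactification_open A -> compactification_open B ->
  compactification_open (A `&` B).
Proof.
move=> [oA infA] [oB infB]; split=> [|r v [Ar Br] rv]; first exact: openI.
have [A1 A2] := infA r v Ar rv; have [B1 B2] := infB r v Br rv; split.
  by apply: filterS2 A1 B1 => -[w t].
by apply: filterS2 A2 B2 => w Aw Bw s sw; split; [exact: Aw | exact: Bw].
Qed.

Lemma compactification_open_bigU (T : Type)
    (f : T -> set (compactification V)) :
  (forall i, compactification_open (f i)) ->
  compactification_open (\bigcup_i f i).
Proof.
move=> of_; split=> [|r v [i _ fir] rv].
  rewrite (_ : [set _ | _] = \bigcup_i [set v | f i (Fin v)]) //.
  by apply: bigcup_open => i _; have [] := of_ i.
have [_ /(_ r v fir rv)[f1 f2]] := of_ i; split.
  by apply: filterS f1 => -[w t] ?; exists i.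
by apply: filterS f2 => w fw s sw; exists i => //; exact: fw.
Qed.

HB.instance Definition _ := isOpenTopological.Build (compactification V)
  compactification_openT compactification_openI compactification_open_bigU.

End Topology.

(* The image of the ray r under a linear map L, seen in the compactification.
   When L is zero on r, the image is not a ray and the value is irrelevant;
   str_iota_infE below shows that only the first case is ever used. *)
Definition ray_image {V W : lmodType R} (L : V -> W) (r : ray V) :
    compactification W :=
  if pselect (is_ray (L @` sval r)) is left Lr then Inf (exist _ _ Lr)
  else Fin 0.

End Compactification.

Arguments Fin {R V} _.
Arguments Inf {R V} _.

(** * The spaces Xi *)

Section Xi.
Variables (R : realType) (I : finType) (a : {set {set I}}).

Definition constant_on : {pred I -> R} :=
  fun f => [forall A in a, forall i in A, forall j in A, f i == f j].

Lemma constant_onP f : reflect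
  (forall A i j, A \in a -> i \in A -> j \in A -> f i = f j)
  (f \in constant_on).
Proof.
apply: (iffP forall_inP) => [f_a A i j aA Ai Aj | f_a A aA].
  by have /forall_inP/(_ i Ai)/forall_inP/(_ j Aj)/eqP := f_a A aA.
by apply/forall_inP => i Ai; apply/forall_inP => j Aj; apply/eqP/(f_a A).
Qed.

Lemma constant_on_submod : submod_closed constant_on.
Proof.
split=> [|c f g /constant_onP cf /constant_onP cg]; first exact/constant_onP.
apply/constant_onP => A i j aA Ai Aj.
by rewrite /= /GRing.add /= /GRing.scale /= (cf A i j) ?(cg A i j).
Qed.

HB.instance Definition _ :=
  GRing.isSubmodClosed.Build R (I -> R) constant_on constant_on_submod.

Definition Xi : Type := Quotient.quot constant_on.

HB.instance Definition _ := EqQuotient.on Xi.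
HB.instance Definition _ := GRing.Zmodule.on Xi.

Definition Xi_scale (c : R) (x : Xi) : Xi := \pi_Xi (c *: repr x).

Lemma Xi_piP (f g : I -> R) :
  reflect (\pi_Xi f = \pi_Xi g) (f - g \in constant_on).
Proof. by rewrite Quotient.idealrBE; exact: eqP. Qed.

Lemma Xi_scale_pi c f : Xi_scale c (\pi_Xi f) = \pi_Xi (c *: f).
Proof.
by apply/Xi_piP; rewrite -scalerBr rpredZ//; apply/Xi_piP; rewrite reprK.
Qed.

Lemma Xi_pi_add f g : \pi_Xi (f + g) = \pi_Xi f + \pi_Xi g.
Proof. exact: (@Quotient.pi_add _ (constant_on : zmodClosed _)). Qed.

Fact Xi_scaleA b c x : Xi_scale b (Xi_scale c x) = Xi_scale (b * c) x.
Proof. by elim/quotW: x => f; rewrite (Xi_scale_pi c) !Xi_scale_pi scalerA. Qed.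

Fact Xi_scale1 : left_id 1 Xi_scale.
Proof. by elim/quotW => f; rewrite Xi_scale_pi scale1r. Qed.

Fact Xi_scaleDr : right_distributive Xi_scale +%R.
Proof.
move=> c; elim/quotW => f; elim/quotW => g.
by rewrite -Xi_pi_add !Xi_scale_pi scalerDr Xi_pi_add.
Qed.

Fact Xi_scaleDl x : {morph Xi_scale^~ x : b c / b + c}.
Proof.
by elim/quotW: x => f b c; rewrite !Xi_scale_pi scalerDl Xi_pi_add.
Qed.

HB.instance Definition _ := GRing.Zmodule_isLmodule.Build R Xi
  Xi_scaleA Xi_scale1 Xi_scaleDr Xi_scaleDl.

(* The quotient topology of the product topology on I -> R. *)
Definition Xi_open (U : set Xi) : Prop := open (\pi_Xi @^-1` U).

Fact Xi_openT : Xi_open setT. Proof. exact: openT. Qed.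

Fact Xi_openI (A B : set Xi) : Xi_open A -> Xi_open B -> Xi_open (A `&` B).
Proof. exact: openI. Qed.

Fact Xi_open_bigU (T : Type) (f : T -> set Xi) :
  (forall i, Xi_open (f i)) -> Xi_open (\bigcup_i f i).
Proof. by move=> of_; apply: bigcup_open => i _; exact: of_. Qed.

HB.instance Definition _ := isOpenTopological.Build Xi
  Xi_openT Xi_openI Xi_open_bigU.

Definition generic (f : I -> R) : Prop :=
  forall A i j, A \in a -> i \in A -> j \in A -> i != j -> f i != f j.

Definition gen_ray : Type :=
  {r : ray Xi | exists2 f, generic f & sval r = open_ray (\pi_Xi f)}.

End Xi.

(* The space of functions modulo constant functions. *)
Definition Xi1 (R : realType) (I : finType) : Type := Xi R [set [set: I]]%SET.

Definition refines (I : finType) (b a : {set {set I}}) : bool :=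
  [forall B in b, exists A in a, B \subset A].

(* The map induced by f |-> f \o h, when Xi_pullback_pi applies. *)
Definition Xi_pullback (R : realType) (I K : finType) (h : I -> K)
    (a : {set {set K}}) (b : {set {set I}}) (x : Xi R a) : Xi R b :=
  \pi_(Xi R b) (repr x \o h).

Lemma Xi_pullback_pi (R : realType) (I K : finType) (h : I -> K)
    (a : {set {set K}}) (b : {set {set I}}) (f : K -> R) :
  (forall B, B \in b -> exists2 A, A \in a & h @: B \subset A) ->
  Xi_pullback h b (\pi_(Xi R a) f) = \pi_(Xi R b) (f \o h).
Proof.
move=> hba; apply/Xi_piP/constant_onP => B i j bB Bi Bj.
have [A aA /fintype.subsetP hBA] := hba B bB.
have /Xi_piP/constant_onP/(_ A (h i) (h j) aA) :=
  reprK (\pi_(Xi R a) f).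
by apply; apply: hBA; apply: imset_f.
Qed.

Definition Xi_proj (R : realType) (I : finType) (a b : {set {set I}}) :
  Xi R a -> Xi R b := Xi_pullback id b.

(** * Partitions and leveled tree-partitions *)

Record setpart (I : finType) : Type := SetPart {
  blocks :> {set {set I}};
  _ : finset.partition blocks [set: I]
}.

HB.instance Definition _ (I : finType) := [isSub for @blocks I].
HB.instance Definition _ (I : finType) := [Finite of setpart I by <:].

Section QuotientSet.
Variables (I : finType) (c : setpart I).

Definition quoset : finType := {B : {set I} | B \in (c : {set {set I}})}.

Lemma pblock_blocks i : finset.pblock c i \in (c : {set {set I}}).
Proof.
by rewrite finset.pblock_mem// (finset.cover_partition (valP c)) inE.
Qed.

Definition quomap (i : I) : quoset :=
  exist _ (finset.pblock c i) (pblock_blocks i).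

(* a / c, for c a refinement of a *)
Definition quopart (a : setpart I) : {set {set quoset}} :=
  [set quomap @: (A : {set I}) | A in (a : {set {set I}})].

End QuotientSet.

(* p.1 is a_0 and p.2 is the sequence a_1, ..., a_tau. *)
Definition leveled_tree_partition (I : finType) : Type :=
  {p : setpart I * seq (setpart I) |
    (p.1 == [set [set: I]]%SET :> {set {set I}}) &&
    path [rel a b : setpart I | refines b a && (b != a)] p.1 p.2}.

Section Strata.
Variables (R : realType) (I : finType).
Implicit Type A : leveled_tree_partition I.

Definition depth A : nat := size (val A).2.

(* The value is meaningful only for j <= depth A. *)
Definition level A (j : nat) : setpart I :=
  nth (val A).1 ((val A).1 :: (val A).2) j.

(* The product of W_0, ..., W_(tau-1) (first factor) and W_tau. *)
Definition Str A : Type :=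
  ((forall j : 'I_(depth A), gen_ray R (quopart (level A j.+1) (level A j))) *
   Xi R (level A (depth A)))%type.

Definition Karp_ambient : topologicalType :=
  prod_topology (fun b : setpart I => compactification (Xi R b)).

Definition max_level A (b : setpart I) : nat :=
  \max_(j < (depth A).+1 | refines b (level A j)) j.

Definition str_iota_inf A (u : Str A) (b : setpart I) (j : 'I_(depth A)) :
    compactification (Xi R b) :=
  ray_image (@Xi_proj R I (level A j) b \o
             @Xi_pullback R I _ (quomap (level A j.+1)) _ (level A j))
            (sval (u.1 j)).

(* For j = max_level A b < depth A, the component at b is always at infinity. *)
Lemma str_iota_infE A (u : Str A) (b : setpart I) (j : 'I_(depth A)) :
  refines b (level A j) -> ~~ refines b (level A j.+1) ->
  exists s f, [/\ str_iota_inf u b j = Inf s,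
    generic (quopart (level A j.+1) (level A j)) f,
    sval (sval (u.1 j)) = open_ray (\pi_(Xi R _) f) &
    sval s = open_ray (\pi_(Xi R b) (f \o quomap (level A j.+1)))].
Proof.
have piZ K (e : {set {set K}}) (h : K -> R) c :
    c *: \pi_(Xi R e) h = \pi_(Xi R e) (c *: h).
  exact: Xi_scale_pi.
move=> rb nrb; rewrite /str_iota_inf; case: (u.1 j) => /= r [f gf rE].
set L := (_ \o _).
have LE g : L (\pi g) = \pi_(Xi R b) (g \o quomap (level A j.+1)).
  rewrite /L /= Xi_pullback_pi => [|B aB].
    rewrite /Xi_proj Xi_pullback_pi // => B bB.
    have /exists_inP[C aC BC] := forall_inP rb B bB.
    exists C => //; apply/fintype.subsetP => x /imsetP[y yB ->].
    exact: (fintype.subsetP BC).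
  by exists [set quomap (level A j.+1) i | i in B]%SET => //; apply: imset_f.
have LZ c g : L (c *: \pi_(Xi R _) g) = c *: L (\pi_(Xi R _) g).
  by rewrite piZ !LE piZ; congr (\pi_(Xi R b) _).
have Lim : L @` sval r = open_ray (\pi_(Xi R b) (f \o quomap (level A j.+1))).
  rewrite rE; apply/seteqP; split=> x /=.
    by move=> [_ [t t0 <-] <-]; exists t => //; rewrite LZ LE.
  by move=> [t t0 <-]; exists (t *: \pi_(Xi R _) f); [exists t|rewrite LZ LE].
have L0 : is_ray (L @` sval r).
  eexists; last exact: Lim.
  apply/eqP => L0; move/negP: nrb; apply; apply/forall_inP => B bB.
  have [B0|[i iB]] := set_0Vmem B.
    by move: bB; rewrite B0; have /and3P[_ _ /negP] := valP b.
  apply/exists_inP; exists (finset.pblock (level A j.+1) i).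
    exact: pblock_blocks.
  have cov k : k \in finset.pblock (level A j.+1) k.
    rewrite finset.mem_pblock.
    by rewrite (finset.cover_partition (valP (level A j.+1))) inE.
  apply/fintype.subsetP => k kB.
  have /exists_inP[C aC BC] := forall_inP rb B bB.
  suff qE : quomap (level A j.+1) i = quomap (level A j.+1) k.
    by have := congr1 val qE => /= ->.
  apply/eqP/negPn/negP => neq.
  have /eqP := gf (quomap (level A j.+1) @: C)%SET _ _ (imset_f _ aC)
    (imset_f _ (fintype.subsetP BC _ iB)) (imset_f _ (fintype.subsetP BC _ kB))
    neq.
  apply; move: L0.
  rewrite -(scale0r (\pi_(Xi R b) (f \o quomap (level A j.+1)))) piZ.
  rewrite scale0r => /Xi_piP; rewrite subr0 => /constant_onP H.
  exact: (H B).
exists (exist _ _ L0), f; split => //=.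
rewrite /ray_image; case: pselect => // L1.
by congr (Inf (exist _ _ _)); exact: Prop_irrelevance.
Qed.

Definition str_iota A (u : Str A) : Karp_ambient := fun b =>
  if insub (max_level A b) is Some j then str_iota_inf u b j
  else Fin (Xi_proj b u.2).

Definition Karp_diag (x : Xi1 R I) : Karp_ambient := fun b => Fin (Xi_proj b x).

Definition Karp : set Karp_ambient := closure (range Karp_diag).

End Strata.

Arguments Karp_ambient R I : clear implicits.
Arguments Karp R I : clear implicits.
Arguments str_iota {R I} A u.

(* Main.v *)
Require Import Defs.
From mathcomp Require Import all_boot all_order all_algebra generic_quotient.
From mathcomp Require Import all_classical all_reals all_analysis.
From mathcomp Require Import ring lra.

Set Implicit Arguments.
Unset Strict Implicit.
Unset Printing Implicit Defensive.

Import Order.TTheory GRing.Theory Num.Theory.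
Import numFieldNormedType.Exports.
Import ArrowAsProduct.

Local Open Scope classical_set_scope.
Local Open Scope ring_scope.
Local Open Scope quotient_scope.

(** For a continuous linear functional l the set {l > c}, completed by the rays
on which l > 0, is open in the compactification, and these halfspaces separate
points. If b refines a, a halfspace of Xi[J; b] pulls back to a halfspace of
Xi[J; a]; hence on Karp_n the component at a determines the component at b, as
soon as the projection is defined on it.

Given y in Karp_n, start from a_0 = {J}: while the component of y at a_j is a
ray, spanned by a function F_j, split the blocks of a_j into the level sets of
F_j to get a_(j+1). This stops at a finite component, and by the first paragraph
all components of y are then those prescribed by the stratum. The same recipe
recovers the leveled tree-partition from any point of a stratum, so strata are
disjoint. Conversely, the point of Str(A) given by F_0, ..., F_(tau-1) and F_tau
is the limit of the classes of sum_i t^(tau-i) F_i as t tends to infinity. *)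

(** * Rays in a real vector space *)

Section OpenRay.
Variables (R : realType) (V : lmodType R).

Lemma open_ray_self (v : V) : open_ray v v.
Proof. by exists 1; rewrite //= ?scale1r. Qed.

Lemma open_rayZ (t : R) (v : V) : 0 < t -> open_ray (t *: v) = open_ray v.
Proof.
move=> t0; apply/seteqP; split=> _ [s s0 <-].
  by exists (s * t); rewrite ?scalerA //= mulr_gt0.
by exists (s / t); rewrite ?scalerA ?divfK ?gt_eqF //= divr_gt0.
Qed.

Lemma open_rayP (v w : V) :
  open_ray v = open_ray w -> exists2 t : R, 0 < t & v = t *: w.
Proof.
by move=> vw; have := open_ray_self v; rewrite vw => -[t t0 <-]; exists t.
Qed.

Lemma ray_eq (r s : ray V) : sval r = sval s -> r = s.
Proof.
case: r s => [r rr] [s rs] /= E; case: _ / E in rs *.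
by congr exist; exact: Prop_irrelevance.
Qed.

Lemma ray_gen (r : ray V) : exists2 v, v != 0 & sval r = open_ray v.
Proof. exact: (svalP r). Qed.

Lemma ray_ex (v : V) : v != 0 -> exists r : ray V, sval r = open_ray v.
Proof. by move=> v0; exists (exist _ _ (ex_intro2 _ _ v v0 erefl)). Qed.

End OpenRay.

(** * Open halfspaces of the compactification and separation of its points *)

Section Halfspace.
Variables (R : realType) (V : preTopologicalLmodType R).

(** The bound [c] disappears at infinity: along a ray on which [l] is positive, a homogeneous [l]
    eventually exceeds every [c], and it does not matter which [v] on the ray is tested. *)
Definition halfspace (l : V -> R) (c : R) : set (compactification V) :=
  fun p => match p with
  | Fin v => c < l v
  | Inf r => exists2 v, sval r v & 0 < l v
  end.

Lemma open_halfspace (l : V -> R) (c : R) :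
  continuous l -> (forall t v, l (t *: v) = t * l v) -> open (halfspace l c).
Proof.
move=> lc lZ; have lpos (r : ray V) v : halfspace l c (Inf r) -> sval r v -> 0 < l v.
  move=> [w rw lw] rv; have [u _ rE] := ray_gen r; move: rv rw.
  rewrite rE => -[t t0 <-] [s s0 ws].
  by move: lw; rewrite -ws !lZ !pmulr_rgt0.
split=> [|r v /lpos + rv] /=.
  rewrite (_ : [set _ | _] = l @^-1` [set x | c < x]) //.
  by apply: open_comp; [move=> x _; exact: lc | exact: open_gt].
move=> /(_ _ rv) lv; have lv2 : 0 < l v / 2 by lra.
have lw : \forall w \near v, l v / 2 < l w.
  by apply: (cvgr_gt (l v)); [exact: lc | lra].
split; last first.
  apply: filterS lw => w lw s sw; exists w => //; exact: lt_trans lw.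
(* Beyond this threshold [l (t *: w) = t * l w > t * (l v / 2) > c]; the maximum with 0 makes [t]
   positive. *)
exists ([set w | l v / 2 < l w], [set t | Num.max 0 (c / (l v / 2)) < t]) => /=.
  by split; [exact: lw | apply: nbhs_pinfty_gt; exact: num_real].
move=> [w t] /= [lw' ]; rewrite gt_max => /andP[t0 ct]; rewrite lZ.
by rewrite ltr_pdivrMr // in ct; apply: (lt_trans ct); rewrite ltr_pM2l.
Qed.

(* The halfspaces of a continuous inner product B separate the points of the
   compactification; for two rays, spanned by v and w, the separating functional
   is the pairing with v / |v| - w / |w|. *)
Lemma halfspace_separation (B : V -> V -> R) (p q : compactification V) :
  (forall c x y z, B (c *: x + y) z = c * B x z + B y z) ->
  (forall x y, B x y = B y x) -> (forall x, x != 0 -> 0 < B x x) -> p <> q ->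
  exists w c, halfspace (B^~ w) c p /\ halfspace (B^~ (- w)) (- c) q.
Proof.
move=> BL Bsym Bpos.
have BN x y : B x (- y) = - B x y.
  have B0 : B 0 x = 0 by have := BL 1 0 0 x; rewrite scale1r addr0 mul1r; lra.
  rewrite Bsym -scaleN1r -[_ *: _]addr0 BL B0 Bsym; lra.
have BNl x y : B (- x) y = - B x y by rewrite Bsym BN Bsym.
have BD x y z : B (x + y) z = B x z + B y z.
  by rewrite -[x in LHS]scale1r BL mul1r.
have BZ c x y : B (c *: x) y = c * B x y.
  have B0 : B 0 y = 0 by have := BL 1 0 0 y; rewrite scale1r addr0 mul1r; lra.
  by rewrite -[_ *: _]addr0 BL B0 addr0.
have BZr c x y : B x (c *: y) = c * B x y by rewrite Bsym BZ Bsym.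
have BDr x y z : B z (x + y) = B z x + B z y by rewrite Bsym BD !(Bsym z).
(* The pairing with [- u] is negative along the ray of [u], whatever the bound; subtracting 1 puts
   [v] strictly inside its halfspace. *)
have finf v (r : ray V) : exists w c, halfspace (B^~ w) c (Fin v) /\
    halfspace (B^~ (- w)) (- c) (Inf r).
  have [u u0 rE] := ray_gen r; exists (- u), (B v (- u) - 1); split => /=; first lra.
  by exists u; [rewrite rE; exact: open_ray_self | rewrite opprK Bpos].
case: p q => [v|r] [w|s] pq; first 1 last.
- exact: finf.
- have [x [c [h1 h2]]] := finf w r.
  by exists (- x), (- c); rewrite !opprK.
- have [v v0 rE] := ray_gen r; have [w w0 sE] := ray_gen s.
  set N := Num.sqrt (B v v); set M := Num.sqrt (B w w).
  have N0 : 0 < N by rewrite sqrtr_gt0 Bpos.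
  have M0 : 0 < M by rewrite sqrtr_gt0 Bpos.
  have NE : B v v = N ^+ 2 by rewrite sqr_sqrtr ?ltW ?Bpos.
  have ME : B w w = M ^+ 2 by rewrite sqr_sqrtr ?ltW ?Bpos.
  (* This is [N * M] times the difference of the two unit vectors, a scaling that avoids
     division. *)
  set x := M *: v - N *: w.
  have x0 : x != 0.
    apply/eqP => /subr0_eq E; apply: pq; congr Inf; apply: ray_eq => /=.
    by rewrite rE sE -(open_rayZ v M0) E open_rayZ.
  (* Positivity of [B x x] amounts to the strict Cauchy-Schwarz inequality [B v w < N * M], from
     which both required signs follow. *)
  have := Bpos _ x0; rewrite /x !(BD, BZ, BNl, BN, BDr, BZr) (Bsym w v) NE ME.
  rewrite (_ : _ - _ = (2 * N * M) * (N * M - B v w)); last by ring.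
  rewrite pmulr_rgt0 ?mulr_gt0 // => NM.
  exists x, 0; split; [exists v | exists w]; rewrite ?rE ?sE; try exact: open_ray_self.
    rewrite /x !(BD, BZ, BNl, BN, BDr, BZr) NE.
    by rewrite (_ : _ - _ = N * (N * M - B v w)) ?mulr_gt0 //; ring.
  rewrite /x !(BD, BZ, BNl, BN, BDr, BZr) ME (Bsym w).
  by rewrite (_ : - _ = M * (N * M - B v w)) ?mulr_gt0 //; ring.
- have vw : v - w != 0 by rewrite subr_eq0; apply/eqP => E; apply: pq; rewrite E.
  (* The bound is the midpoint of the values at [v] and [w], which differ by [B (v - w) (v - w)]. *)
  exists (v - w), ((B v (v - w) + B w (v - w)) / 2) => /=; rewrite BN.
  by have := Bpos _ vw; rewrite {1}BD BNl; lra.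
Qed.

End Halfspace.

(** * Partitions seen as equivalence relations *)

Section SameBlock.
Variable I : finType.
Implicit Types a b c : setpart I.

Definition same_block a : rel I := fun i k => k \in finset.pblock a i.

Lemma same_blockE a A i k :
  A \in (a : {set {set I}}) -> i \in A -> same_block a i k = (k \in A).
Proof.
by move=> aA iA; rewrite /same_block (def_pblock _ aA iA) //; have /and3P[] := valP a.
Qed.

Lemma same_block_eqv a : equivalence_rel (same_block a).
Proof.
move=> i k l; have := pblock_equivalence (valP a).
by move=> /(_ i k l (finset.in_setT i) (finset.in_setT k) (finset.in_setT l)).
Qed.

Lemma same_block_refl a i : same_block a i i.
Proof. by have [] := same_block_eqv a i i i. Qed.

Lemma setpart_ext a b : same_block a =2 same_block b -> a = b.
Proof.
move=> ab; apply: val_inj => /=.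
rewrite -(equivalence_partition_pblock (valP a)).
rewrite -(equivalence_partition_pblock (valP b)).
apply: eq_imset => i; apply/setP => k; rewrite !inE; exact: ab.
Qed.

Lemma refinesP b a :
  reflect (forall i k, same_block b i k -> same_block a i k) (refines b a).
Proof.
apply: (iffP forall_inP) => [ba i k ik|ba B bB].
  have /exists_inP[A aA /fintype.subsetP BA] := ba _ (pblock_blocks b i).
  rewrite (same_blockE _ aA); first exact: BA.
  by apply: BA; exact: (same_block_refl b i).
have [B0|[i iB]] := set_0Vmem B.
  by move: bB; rewrite B0; have /and3P[_ _ /negP] := valP b.
apply/exists_inP; exists (finset.pblock a i); first exact: pblock_blocks.
by apply/fintype.subsetP => k kB; apply: ba; rewrite (same_blockE _ bB).
Qed.

Lemma refines_refl a : refines a a.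
Proof. exact/refinesP. Qed.

Lemma refines_trans a b c : refines c b -> refines b a -> refines c a.
Proof. by move=> /refinesP cb /refinesP ba; apply/refinesP => i k /cb/ba. Qed.

Lemma refines_anti a b : refines a b -> refines b a -> a = b.
Proof.
move=> /refinesP ab /refinesP ba; apply: setpart_ext => i k.
by apply/idP/idP => [/ab|/ba].
Qed.

Lemma setpart_of_equivalence (e : rel I) :
  equivalence_rel e -> exists a, same_block a =2 e.
Proof.
move=> eE; have eE' : {in [set: I]%SET & &, equivalence_rel e} by move=> ? ? ? _ _ _.
exists (SetPart (equivalence_partitionP eE')) => i k.
by rewrite /same_block (pblock_equivalence_partition eE') ?inE.
Qed.

End SameBlock.

Arguments refinesP {I b a}.

(** * Representatives, topology and inner product on the spaces [Xi] *)

Section XiLift.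
Variables (R : realType) (I : finType) (a : {set {set I}}).
Implicit Types f g : I -> R.

Lemma Xi_piD f g : \pi_(Xi R a) (f + g) = \pi_(Xi R a) f + \pi_(Xi R a) g.
Proof. exact: Xi_pi_add. Qed.

Lemma Xi_piZ c f : \pi_(Xi R a) (c *: f) = c *: \pi_(Xi R a) f.
Proof. by rewrite -Xi_scale_pi. Qed.

Lemma Xi_proj_pi (b : {set {set I}}) f : refines b a ->
  Xi_proj b (\pi_(Xi R a) f) = \pi_(Xi R b) f.
Proof.
move=> ba; rewrite /Xi_proj Xi_pullback_pi // => B bB.
have /exists_inP[A aA BA] := forall_inP ba B bB.
by exists A; rewrite // imset_id.
Qed.

End XiLift.

Section XiTopology.
Variables (R : realType) (I : finType).
Implicit Types (a b : setpart I) (f g : I -> R).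

Lemma Xi_eqP a f g : \pi_(Xi R a) f = \pi_(Xi R a) g <->
  forall i k, same_block a i k -> f i - f k = g i - g k.
Proof.
split=> [/Xi_piP/constant_onP fg i k ik|fg].
  have : f i - g i = f k - g k :=
    fg _ i k (pblock_blocks a i) (same_block_refl a i) ik.
  by lra.
apply/Xi_piP/constant_onP => A i k aA iA kA.
have := fg i k; rewrite (same_blockE _ aA iA) => /(_ kA) E.
by suff: f i - g i = f k - g k by []; lra.
Qed.

Lemma Xi_pi_eq0 a f : \pi_(Xi R a) f = 0 <->
  forall i k, same_block a i k -> f i = f k.
Proof.
have -> : 0 = \pi_(Xi R a) 0 by rewrite -(scale0r (\pi_(Xi R a) 0)) -Xi_piZ scale0r.
rewrite Xi_eqP; split=> fE i k /fE E; last by rewrite E !subrr.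
by apply/eqP; rewrite -subr_eq0 E; exact/eqP/subrr.
Qed.

Lemma Xi_proj_id a (x : Xi R a) : Xi_proj a x = x.
Proof. by elim/quotW: x => f; rewrite Xi_proj_pi ?refines_refl. Qed.

Lemma Xi_projZ a b (t : R) (x : Xi R a) : refines b a ->
  Xi_proj b (t *: x) = t *: Xi_proj b x.
Proof. by move=> ba; elim/quotW: x => f; rewrite -Xi_piZ !Xi_proj_pi // Xi_piZ. Qed.

Lemma pi_Xi_continuous a : continuous (\pi_(Xi R a) : (I -> R) -> Xi R a).
Proof. by apply/continuousP => U oU. Qed.

Lemma continuous_Xi a (T : topologicalType) (h : Xi R a -> T) :
  continuous (fun f : I -> R => h (\pi_(Xi R a) f)) -> continuous h.
Proof. by move=> /continuousP hc; apply/continuousP => U /hc. Qed.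

Lemma Xi_proj_continuous a b : refines b a ->
  continuous (Xi_proj b : Xi R a -> Xi R b).
Proof.
move=> ba; apply: continuous_Xi.
rewrite (_ : (fun _ => _) = \pi_(Xi R b)); first exact: pi_Xi_continuous.
by apply: funext => f; rewrite Xi_proj_pi.
Qed.

(** An inner product: differences within a block do not depend on the representative, and they all
    vanish only for the zero class. *)
Definition Xi_form a (x y : Xi R a) : R :=
  \sum_i \sum_(k | same_block a i k)
    (repr x i - repr x k) * (repr y i - repr y k).

Lemma Xi_form_pi a f g : Xi_form (\pi_(Xi R a) f) (\pi_(Xi R a) g) =
  \sum_i \sum_(k | same_block a i k) (f i - f k) * (g i - g k).
Proof.
have reprE h i k : same_block a i k ->
    repr (\pi_(Xi R a) h) i - repr (\pi_(Xi R a) h) k = h i - h k.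
  by move=> ik; apply: (Xi_eqP a _ _).1 ik; rewrite reprK.
apply: eq_bigr => i _; apply: eq_bigr => k ik.
by rewrite (reprE f) ?(reprE g).
Qed.

Lemma Xi_form_linear a c (x y z : Xi R a) :
  Xi_form (c *: x + y) z = c * Xi_form x z + Xi_form y z.
Proof.
elim/quotW: x => f; elim/quotW: y => g; elim/quotW: z => h.
rewrite -Xi_piZ -Xi_piD !Xi_form_pi mulr_sumr -big_split /=.
apply: eq_bigr => i _; rewrite mulr_sumr -big_split /=; apply: eq_bigr => k _.
rewrite -[(_ + _) i]/(c * f i + g i) -[(_ + _) k]/(c * f k + g k); ring.
Qed.

Lemma Xi_formC a (x y : Xi R a) : Xi_form x y = Xi_form y x.
Proof. by apply: eq_bigr => i _; apply: eq_bigr => k _; rewrite mulrC. Qed.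

Lemma Xi_form_gt0 a (x : Xi R a) : x != 0 -> 0 < Xi_form x x.
Proof.
have ge0 i : 0 <= \sum_(k | same_block a i k)
    (repr x i - repr x k) * (repr x i - repr x k).
  by apply: sumr_ge0 => k _; rewrite -expr2 sqr_ge0.
move=> x0; rewrite lt_neqAle sumr_ge0 // andbT eq_sym; apply: contra x0 => /eqP F0.
apply/eqP; rewrite -[x]reprK; apply/Xi_pi_eq0 => i k ik.
have {}F0 := psumr_eq0P (fun i _ => ge0 i) F0 (isT : xpredT i).
have ge0k k' : same_block a i k' ->
    0 <= (repr x i - repr x k') * (repr x i - repr x k').
  by rewrite -expr2 sqr_ge0.
apply/eqP; rewrite -subr_eq0; have /eqP := psumr_eq0P ge0k F0 ik.
by rewrite mulf_eq0 orbb.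
Qed.

(** By the quotient topology it suffices to test on representatives, where the form is a finite sum
    of coordinate differences times constants. *)
Lemma Xi_form_continuous a (y : Xi R a) : continuous (@Xi_form a ^~ y).
Proof.
apply: continuous_Xi; elim/quotW: y => g.
rewrite (_ : (fun _ => _) = fun f : I -> R =>
  \sum_i \sum_(k | same_block a i k) (f i - f k) * (g i - g k)); last first.
  by apply: funext => f; rewrite Xi_form_pi.
have addc := @add_continuous R.
apply: (@continuous_big R I +%R 0 _ addc) => i _.
apply: (@continuous_big R I +%R 0 _ addc) => k _ f.
have fc l : (fun h : I -> R => h l) @ f --> f l := @proj_continuous I (fun=> R) l f.
have fikc : (fun h : I -> R => h i - h k) @ f --> f i - f k.
  exact: (cvgB (fc i) (fc k)).
exact: (cvgMr_tmp fikc).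
Qed.

Lemma compactification_Xi_separation a (p q : compactification (Xi R a)) :
  p <> q -> exists w c, halfspace (@Xi_form a ^~ w) c p /\
    halfspace (@Xi_form a ^~ (- w)) (- c) q.
Proof.
apply: halfspace_separation; [exact: Xi_form_linear|exact: Xi_formC|].
exact: Xi_form_gt0.
Qed.

End XiTopology.

(** * How the components of a point of the Karpelevich polyhedron constrain each other *)

Section KarpClosure.
Variables (R : realType) (I : finType).
Implicit Types (a b : setpart I) (y : Karp_ambient R I).

Lemma refines_top b : refines b [set [set: I]]%SET.
Proof.
by apply/forall_inP => B _; apply/exists_inP; exists [set: I]%SET; rewrite ?inE.
Qed.

Lemma Karp_diag_pi (f : I -> R) b :
  Karp_diag (\pi_(Xi1 R I) f) b = Fin (\pi_(Xi R b) f).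
Proof. by rewrite /Karp_diag Xi_proj_pi ?refines_top. Qed.

(** Both conditions are open in the product, so if they held at [y] they would hold together at some
    diagonal point. There both components come from one function, on which [l] would be at once
    above and below [c]. *)
Lemma Karp_halfspace y a b (l : Xi R b -> R) c :
  refines b a -> continuous l -> (forall t x, l (t *: x) = t * l x) ->
  Karp R I y -> halfspace (l \o @Xi_proj R I a b) c (y a) ->
  ~ halfspace (fun x => - l x) (- c) (y b).
Proof.
move=> ba lc lZ Ky ya yb.
have projc d : continuous (fun z : Karp_ambient R I => z d) :=
  @proj_continuous (setpart I) (fun d => compactification (Xi R d)) d.
have ya_nbhs : nbhs y [set z | halfspace (l \o @Xi_proj R I a b) c (z a)].
  apply: (projc a y); apply: open_nbhs_nbhs; split => //.
  apply: open_halfspace => [x|t x] /=; last by rewrite Xi_projZ.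
  by apply: continuous_comp; [exact: Xi_proj_continuous | exact: lc].
have yb_nbhs : nbhs y [set z | halfspace (fun x => - l x) (- c) (z b)].
  apply: (projc b y); apply: open_nbhs_nbhs; split => //.
  by apply: open_halfspace => [x|t x]; [exact: (cvgN (lc x)) | rewrite lZ mulrN].
have [_ [[x _ <-] [xa xb]]] := Ky _ (filterI ya_nbhs yb_nbhs).
have {}xa : halfspace (l \o @Xi_proj R I a b) c (Karp_diag x a) := xa.
have {}xb : halfspace (fun x => - l x) (- c) (Karp_diag x b) := xb.
have xE : x = \pi_(Xi1 R I) (repr x) by rewrite reprK.
move: xa xb; rewrite xE !Karp_diag_pi /halfspace ltrN2 /comp Xi_proj_pi // => cl lc'.
by have := lt_trans cl lc'; rewrite ltxx.
Qed.

(** If [y b] differed from [p], some halfspace would contain [p] with the opposite one containing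
    [y b]; pulled back to [a], this contradicts [Karp_halfspace]. *)
Lemma Karp_eq y a b (p : compactification (Xi R b)) :
  refines b a -> Karp R I y ->
  (forall w c, halfspace (@Xi_form R I b ^~ w) c p ->
    halfspace ((@Xi_form R I b ^~ w) \o @Xi_proj R I a b) c (y a)) ->
  y b = p.
Proof.
move=> ba Ky H; apply: contrapT => /nesym /compactification_Xi_separation.
have formZ t x z : @Xi_form R I b (t *: x) z = t * Xi_form x z.
  have F0 : @Xi_form R I b 0 z = 0.
    by have := Xi_form_linear 1 0 0 z; rewrite scaler0 addr0; lra.
  by rewrite -[t *: x]addr0 Xi_form_linear F0 addr0.
move=> [w [c [/H ya]]].
rewrite (_ : @Xi_form R I b ^~ (- w) = fun x => - Xi_form x w).
  by apply: Karp_halfspace ya => //; exact: Xi_form_continuous.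
by apply: funext => x; rewrite Xi_formC -scaleN1r formZ mulN1r Xi_formC.
Qed.

Lemma Karp_Fin y a b (x : Xi R a) : refines b a -> Karp R I y ->
  y a = Fin x -> y b = Fin (Xi_proj b x).
Proof. by move=> ba Ky ya; apply: (Karp_eq ba Ky) => w c; rewrite ya. Qed.

Lemma Karp_Inf y a b r (f : I -> R) : refines b a -> Karp R I y ->
  y a = Inf r -> sval r = open_ray (\pi_(Xi R a) f) -> \pi_(Xi R b) f != 0 ->
  exists2 s, y b = Inf s & sval s = open_ray (\pi_(Xi R b) f).
Proof.
move=> ba Ky ya rE f0; have [s sE] := ray_ex f0; exists s => //.
apply: (Karp_eq ba Ky) => w c; rewrite ya /= sE rE => -[_ [t t0 <-] tf].
exists (t *: \pi_(Xi R a) f); first by exists t.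
by rewrite /= Xi_projZ // Xi_proj_pi.
Qed.

End KarpClosure.

(** * One refinement step encoded by a function on [I] *)

Section Layers.
Variables (R : realType) (I : finType).
Implicit Types (a b : setpart I) (F : I -> R).

(* Pulled back to I, the generic functions on I / a' for a / a' are exactly the F
   with [layer a a' F]. *)
Definition layer a a' F : Prop :=
  forall i k, same_block a' i k = same_block a i k && (F i == F k).

Lemma layer_refines a a' F : layer a a' F -> refines a' a.
Proof. by move=> aF; apply/refinesP => i k; rewrite aF => /andP[]. Qed.

(** If [F] were constant on the blocks of [b], then [b] would refine [a']. Thus the ray of [F]
    survives the projection to such a [b]. *)
Lemma layer_Xi_neq0 a a' b F : layer a a' F -> refines b a -> ~~ refines b a' ->
  \pi_(Xi R b) F != 0.
Proof.
move=> aF /refinesP ba; apply: contra => /eqP/Xi_pi_eq0 F0.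
by apply/refinesP => i k ik; rewrite aF ba //=; apply/eqP/F0.
Qed.

(** Within a block of [a] the differences of [G] are [t] times those of [F], so the level sets
    agree. Hence the ray at [a] determines [a']. *)
Lemma layer_proportional a a' F G (t : R) : t != 0 -> layer a a' F ->
  \pi_(Xi R a) G = t *: \pi_(Xi R a) F -> layer a a' G.
Proof.
move=> t0 aF; rewrite -Xi_piZ => /Xi_eqP FG i k; rewrite aF.
have [ik|//] := boolP (same_block a i k).
rewrite -subr_eq0 -[G i == _]subr_eq0 (FG i k ik).
rewrite -[(t *: F) i]/(t * F i) -[(t *: F) k]/(t * F k).
by rewrite -mulrBr mulf_eq0 (negPf t0).
Qed.

Lemma quomap_eq a i k : (quomap a i == quomap a k) = same_block a i k.
Proof.
rewrite -val_eqE /= eq_pblock //; first by have /and3P[] := valP a.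
by rewrite (finset.cover_partition (valP a)) inE.
Qed.

Lemma Xi_pullback_quomap a a' b (f : quoset a' -> R) : refines b a ->
  Xi_pullback (quomap a') b (\pi_(Xi R (quopart a' a)) f) =
  \pi_(Xi R b) (f \o quomap a').
Proof.
move=> ba; apply: Xi_pullback_pi => B bB.
have /exists_inP[A aA BA] := forall_inP ba B bB.
by exists [set quomap a' i | i in A]%SET; [exact: imset_f | exact: imsetS].
Qed.

Lemma generic_layer a a' (f : quoset a' -> R) : refines a' a ->
  generic (quopart a' a) f -> layer a a' (f \o quomap a').
Proof.
move=> /refinesP a'a gf i k; apply/idP/andP => [ik|[ik fik]].
  split; first exact: a'a.
  by move: ik; rewrite -quomap_eq => /eqP /= ->.
rewrite -quomap_eq; apply: contraTT fik => nik.
by apply: (gf [set quomap a' l | l in finset.pblock a i]%SET) => //;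
  apply: imset_f; rewrite ?pblock_blocks //; exact: same_block_refl.
Qed.

Lemma layer_generic a a' F : layer a a' F ->
  exists2 f, generic (quopart a' a) f & F = f \o quomap a'.
Proof.
(* [f] reads [F] at any element of the block, on which [F] is constant; blocks are nonempty, so the
   default 0 is never reached. *)
move=> aF; pose f (B : quoset a') : R :=
  if [pick i in (val B : {set I})] is Some i then F i else 0.
have fE i : f (quomap a' i) = F i.
  rewrite /f /=; case: pickP => [k|/(_ i)] /=.
    by rewrite -/(same_block a' i k) aF => /andP[_ /eqP].
  by move=> ii; have := same_block_refl a' i; rewrite /same_block ii.
exists f; last by apply: funext => i; rewrite /= fE.
move=> _ _ _ /imsetP[A aA ->] /imsetP[i iA ->] /imsetP[k kA ->].
by rewrite quomap_eq !fE aF (same_blockE _ aA) // kA.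
Qed.

(** Each element of a block of [quopart a' a] lifts to the corresponding block of [a], so pulling
    back loses no information. *)
Lemma quopart_pi a a' (f g : quoset a' -> R) :
  \pi_(Xi R a) (f \o quomap a') = \pi_(Xi R a) (g \o quomap a') ->
  \pi_(Xi R (quopart a' a)) f = \pi_(Xi R (quopart a' a)) g.
Proof.
move=> /Xi_eqP fg; apply/Xi_piP/constant_onP => A i k /imsetP[A0 aA0 ->].
move=> /imsetP[i0 iA ->] /imsetP[k0 kA ->].
have := fg i0 k0; rewrite (same_blockE _ aA0) // => /(_ kA) /= E.
by suff : f (quomap a' i0) - g (quomap a' i0) =
  f (quomap a' k0) - g (quomap a' k0) by []; lra.
Qed.

End Layers.

(** * Levels of a leveled tree-partition *)

Section Levels.
Variable I : finType.
Implicit Types (A : leveled_tree_partition I) (b : setpart I).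

Lemma level0 A : level A 0 = [set [set: I]]%SET :> {set {set I}}.
Proof. by have /andP[/eqP] := valP A. Qed.

Lemma level_step A j : (j < depth A)%N ->
  refines (level A j.+1) (level A j) /\ level A j.+1 <> level A j.
Proof.
move=> jd; have /andP[_ /(pathP (val A).1)/(_ j jd)/andP[r /eqP]] := valP A.
by [].
Qed.

Lemma level_mono A i j : (i <= j <= depth A)%N -> refines (level A j) (level A i).
Proof.
case/andP; elim: j => [|j IH]; first by rewrite leqn0 => /eqP-> _; exact: refines_refl.
rewrite leq_eqVlt => /predU1P[-> _|ij jd]; first exact: refines_refl.
exact: refines_trans (level_step jd).1 (IH ij (ltnW jd)).
Qed.

Lemma level_strict A i j : (i < j <= depth A)%N -> ~~ refines (level A i) (level A j).
Proof.
move=> /andP[ij jd]; apply/negP => r; have id : (i < depth A)%N := leq_trans ij jd.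
have [ri ni] := level_step id; apply/ni/refines_anti => //.
by apply: refines_trans r _; apply: level_mono; rewrite ij.
Qed.

Lemma level_exists A b :
  refines b (level A (depth A)) \/ exists j, [/\ (j < depth A)%N,
    refines b (level A j) & ~~ refines b (level A j.+1)].
Proof.
suff H m : (m <= depth A)%N -> refines b (level A m) \/ exists j,
    [/\ (j < m)%N, refines b (level A j) & ~~ refines b (level A j.+1)].
  exact: H.
elim: m => [_|m IH md]; first by left; rewrite level0 refines_top.
have [bm|[j [jm r1 r2]]] := IH (ltnW md); last by right; exists j; split; rewrite 1?ltnW.
by have [|nr] := boolP (refines b (level A m.+1)); [left | right; exists m].
Qed.

Lemma max_level_depth A b : refines b (level A (depth A)) -> max_level A b = depth A.
Proof.
move=> bA; apply/eqP; rewrite eqn_leq; apply/andP; split.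
  by apply/bigmax_leqP => i _; rewrite -ltnS ltn_ord.
exact: (@leq_bigmax_cond _ (fun j : 'I_(depth A).+1 => refines b (level A j))
  (fun j => j : nat) ord_max).
Qed.

Lemma max_levelE A b j : (j < depth A)%N -> refines b (level A j) ->
  ~~ refines b (level A j.+1) -> max_level A b = j.
Proof.
move=> jd bj nbj; apply/eqP; rewrite eqn_leq; apply/andP; split.
  apply/bigmax_leqP => i bi; rewrite leqNgt; apply: contra nbj => ji.
  by apply: refines_trans bi _; apply: level_mono; rewrite ji -ltnS ltn_ord.
have jd' : (j < (depth A).+1)%N by rewrite ltnS ltnW.
exact: (@leq_bigmax_cond _ (fun j : 'I_(depth A).+1 => refines b (level A j))
  (fun j => j : nat) (Ordinal jd')).
Qed.

(** Past the depth, [level] returns its default, the top partition; the depths are therefore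
    compared separately. *)
Lemma leveled_tree_partition_ext A B : depth A = depth B ->
  (forall j, (j <= depth A)%N -> level A j = level B j) -> A = B.
Proof.
rewrite /level /depth => dAB lAB; apply: val_inj.
case: A B dAB lAB => [[a s] /= _] [[b t] /= _] dAB lAB.
have E0 := lAB 0%N isT; rewrite /= in E0; rewrite E0; congr pair.
apply: (eq_from_nth (x0 := a)) => // j js; have /= -> := lAB j.+1 js.
by apply: set_nth_default; rewrite -dAB.
Qed.

End Levels.

(** * Images of the strata described by functions on [I]; injectivity and disjointness *)

Section StrataCharacterization.
Variables (R : realType) (I : finType).
Implicit Types (A : leveled_tree_partition I) (b : setpart I)
  (y : Karp_ambient R I).

(** The image of [str_iota A], stated without quotient sets: [F] stands for the pullback of a
    generator of the ray [u_j], and [g] for a representative of the finite part. *)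
Definition in_stratum A y : Prop :=
  (forall j, (j < depth A)%N -> exists F : I -> R,
    layer (level A j) (level A j.+1) F /\
    forall b, refines b (level A j) -> ~~ refines b (level A j.+1) ->
      exists2 s, y b = Inf s & sval s = open_ray (\pi_(Xi R b) F)) /\
  exists g : I -> R, forall b, refines b (level A (depth A)) ->
    y b = Fin (\pi_(Xi R b) g).

Lemma str_iota_Fin A (u : Str R A) b : refines b (level A (depth A)) ->
  str_iota A u b = Fin (Xi_proj b u.2).
Proof.
by move=> bA; rewrite /str_iota max_level_depth //; case: insubP => // j; rewrite ltnn.
Qed.

(** [str_iota_infE] supplies one generator of the ray [u.1 j]; any other generator [f] is a positive
    multiple of it modulo the blocks, so it spans the same image ray. *)
Lemma str_iota_Inf A (u : Str R A) b (j : 'I_(depth A))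
    (f : quoset (level A j.+1) -> R) :
  refines b (level A j) -> ~~ refines b (level A j.+1) ->
  sval (sval (u.1 j)) = open_ray (\pi_(Xi R _) f) ->
  exists2 s, str_iota A u b = Inf s &
    sval s = open_ray (\pi_(Xi R b) (f \o quomap (level A j.+1))).
Proof.
move=> rb nrb uf; have [s [f' [us _ uf' sE]]] := str_iota_infE u rb nrb.
exists s.
  rewrite -us /str_iota (max_levelE (ltn_ord j) rb nrb).
  case: insubP => [i _ ij|]; last by rewrite ltn_ord.
  by have -> : i = j by apply: val_inj.
have [t t0 ff'] := open_rayP (etrans (esym uf') uf).
rewrite sE -(open_rayZ (\pi_(Xi R b) (f \o _)) t0) -Xi_piZ.
congr open_ray; rewrite -(Xi_pullback_quomap f' rb) ff' -Xi_piZ.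
exact: Xi_pullback_quomap.
Qed.

Lemma level_not_refines_succ A j : (j < depth A)%N ->
  ~~ refines (level A j) (level A j.+1).
Proof. by move=> jd; apply: level_strict; rewrite ltnSn. Qed.

Lemma str_iota_in_stratum A (u : Str R A) : in_stratum A (str_iota A u).
Proof.
split=> [j jd|].
  have [f gf uf] := svalP (u.1 (Ordinal jd)).
  exists (f \o quomap (level A j.+1)); split.
    by apply: generic_layer gf; exact: (level_step jd).1.
  by move=> b rb nrb; exact: (@str_iota_Inf A u b (Ordinal jd) f).
by exists (repr u.2) => b bA; rewrite str_iota_Fin.
Qed.

Lemma in_stratum_str_iota A y : in_stratum A y -> exists u, str_iota A u = y.
Proof.
move=> [yInf [g yFin]].
(* The components of the preimage [u] are data, hence the informative existence obtained from
   [cid]. *)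
have H (j : 'I_(depth A)) : {w : gen_ray R (quopart (level A j.+1) (level A j)) |
    exists2 f, sval (sval w) = open_ray (\pi_(Xi R _) f) &
    forall b, refines b (level A j) -> ~~ refines b (level A j.+1) ->
      exists2 s, y b = Inf s &
        sval s = open_ray (\pi_(Xi R b) (f \o quomap (level A j.+1)))}.
  apply: cid; have [F [lF yF]] := yInf j (ltn_ord j).
  have [f gf FE] := layer_generic lF; rewrite {}FE in lF yF.
  have jA := level_not_refines_succ (ltn_ord j).
  have f0 : \pi_(Xi R (quopart (level A j.+1) (level A j))) f != 0.
    apply: contra (layer_Xi_neq0 lF (refines_refl _) jA) => /eqP f0.
    rewrite -(Xi_pullback_quomap f (refines_refl _)) f0.
    rewrite -(scale0r (\pi_(Xi R _) f)) -Xi_piZ.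
    rewrite Xi_pullback_quomap ?refines_refl //.
    by apply/eqP/Xi_pi_eq0 => i k _; rewrite /= scale0r.
  have [r rE] := ray_ex f0.
  by exists (exist _ r (ex_intro2 _ _ f gf rE)), f.
pose u : Str R A := (fun j => sval (H j), \pi_(Xi R (level A (depth A))) g).
exists u; apply: functional_extensionality_dep => b.
have [bA|[j [jd rb nrb]]] := level_exists A b.
  by rewrite str_iota_Fin //= yFin // Xi_proj_pi.
have [f wf yf] := svalP (H (Ordinal jd)).
have [s -> sE] := @str_iota_Inf A u b (Ordinal jd) f rb nrb wf.
have [s' -> s'E] := yf b rb nrb.
by congr Inf; apply: ray_eq; rewrite sE s'E.
Qed.

Lemma range_str_iota A : range (str_iota A : Str R A -> _) = [set y | in_stratum A y].
Proof.
apply/seteqP; split=> [_ [u _ <-]|y /in_stratum_str_iota[u <-]].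
  exact: str_iota_in_stratum.
by exists u.
Qed.

(** The components at the levels themselves suffice: the last one is [u.2], and each earlier one is
    the pullback of the ray [u.1 j], recovered by [quopart_pi]. *)
Lemma str_iota_inj A : injective (str_iota A : Str R A -> Karp_ambient R I).
Proof.
move=> u v uv; rewrite [u]surjective_pairing [v]surjective_pairing.
have uvb b : str_iota A u b = str_iota A v b by rewrite uv.
congr pair; last first.
  have := uvb (level A (depth A)).
  by rewrite !str_iota_Fin ?refines_refl // !Xi_proj_id => -[].
apply: functional_extensionality_dep => j.
have [f _ uf] := svalP (u.1 j); have [g _ vg] := svalP (v.1 j).
have jA := level_not_refines_succ (ltn_ord j).
have [s us sE] := str_iota_Inf (refines_refl _) jA uf.
have [s' vs sE'] := str_iota_Inf (refines_refl _) jA vg.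
have ss' : s = s' by have := uvb (level A j); rewrite us vs => -[].
have [t t0 fg] : exists2 t : R, 0 < t &
    \pi_(Xi R (level A j)) (f \o quomap (level A j.+1)) =
    t *: \pi_(Xi R (level A j)) (g \o quomap (level A j.+1)).
  by apply: open_rayP; rewrite -sE -sE' ss'.
have : sval (u.1 j) = sval (v.1 j).
  apply: ray_eq; rewrite uf vg -(open_rayZ (\pi_(Xi R _) g) t0) -Xi_piZ.
  by congr open_ray; apply: quopart_pi; rewrite fg -Xi_piZ.
case: (u.1 j) (v.1 j) => [r gr] [r' gr'] /= E; case: _ / E in gr' *.
by congr exist; exact: Prop_irrelevance.
Qed.

(** By induction on [m]: at a common level the layer functions of [A] and [B] span the same ray,
    hence cut the blocks into the same level sets. *)
Lemma in_stratum_level A B y m : in_stratum A y -> in_stratum B y ->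
  (m <= depth A)%N -> (m <= depth B)%N /\ level A m = level B m.
Proof.
move=> [yA _] [yB [gB yFB]]; elim: m => [_|m IH mA].
  by split=> //; apply: val_inj; rewrite /= !level0.
have [mB lm] := IH (ltnW mA).
have [F [lF yF]] := yA m mA.
have [s ys sE] := yF _ (refines_refl _) (level_not_refines_succ mA).
(* If [B] stopped at level [m], the component there would be finite, while [A] makes it a ray. *)
move: mB; rewrite leq_eqVlt => /predU1P[mB|mB].
  by move: ys; rewrite yFB // -mB -lm refines_refl.
have [G [lG yG]] := yB m mB; split=> //.
have nB := level_not_refines_succ mB; rewrite -lm in lG yG nB.
have [s' ys' sE'] := yG _ (refines_refl _) nB.
have ss' : s = s' by move: ys; rewrite ys' => -[].
have [t t0 FG] := open_rayP (etrans (esym sE) (etrans (congr1 sval ss') sE')).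
have lF' := layer_proportional (lt0r_neq0 t0) lG FG.
by apply: setpart_ext => i k; rewrite lF lF'.
Qed.

Lemma in_stratum_uniq A B y : in_stratum A y -> in_stratum B y -> A = B.
Proof.
move=> yA yB; apply: leveled_tree_partition_ext => [|j jA].
  apply/eqP; rewrite eqn_leq (in_stratum_level yA yB (leqnn _)).1.
  by rewrite (in_stratum_level yB yA (leqnn _)).1.
exact: (in_stratum_level yA yB jA).2.
Qed.

End StrataCharacterization.

(** * Convergence in products, and curves with separated scales *)

Lemma cvg_prod_topology (J : Type) (K : J -> topologicalType)
    (F : set_system (prod_topology K)) (p : prod_topology K) : Filter F ->
  (forall j (W : set (K j)), open W -> W (p j) -> F [set q | W (q j)]) -> F --> p.
Proof.
move=> FF H; apply/cvg_sup => j U [_ [[W oW <-] Wp WU]].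
exact: filterS WU (H j W oW Wp).
Qed.

Section ScaledCurve.
Variables (R : realType) (I : finType) (d : nat) (F : nat -> I -> R).

Definition scaled_curve (t : R) : I -> R :=
  fun k => \sum_(i < d.+1) t ^+ (d - i) * F i k.

(* The terms of index >= j of [scaled_curve t], divided by t ^ (d - j), form a
   polynomial in s = 1 / t. *)
Definition curve_tail (j : nat) (s : R) : I -> R :=
  fun k => (\poly_(i < (d - j).+1) F (i + j)%N k).[s].

(** Terms of index below [j] agree at [k] and [l] and cancel; what remains has order
    [t ^+ (d - j)]. *)
Lemma scaled_curve_tail j t k l : (j <= d)%N -> t != 0 ->
  (forall i, (i < j)%N -> F i k = F i l) ->
  scaled_curve t k - scaled_curve t l =
    t ^+ (d - j) * (curve_tail j t^-1 k - curve_tail j t^-1 l).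
Proof.
move=> jd t0 Fj; rewrite /scaled_curve /curve_tail !horner_poly -!sumrB.
rewrite -(big_mkord xpredT (fun i => t ^+ (d - i) * F i k - t ^+ (d - i) * F i l)).
rewrite (big_cat_nat (n := j)) //=; last exact: leqW.
rewrite big_nat_cond big1 ?add0r => [|i /andP[/andP[_ ij] _]]; last first.
  by rewrite Fj // subrr.
(* After shifting the index by [j], the factor [t ^+ (d - (i + j))] splits as
   [t ^+ (d - j) * t^-1 ^+ i]. *)
rewrite -{1}[j]add0n big_addn subSn // big_mkord mulr_sumr.
apply: eq_bigr => -[i /= id] _; rewrite -mulrBr -mulrBl [_ * t^-1 ^+ i]mulrC mulrA.
congr (_ * _); rewrite exprVn addnC subnDA.
by rewrite -[in RHS](subnK (m := i) (n := d - j)) // exprD mulfK // expf_neq0.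
Qed.

Lemma curve_tail0 j : curve_tail j 0 = F j.
Proof. by apply: funext => k; rewrite /curve_tail horner_coef0 coef_poly. Qed.

Lemma curve_tail_cvg j : (fun t => curve_tail j t^-1) @ +oo --> F j.
Proof.
apply: (@cvg_prod_topology I (fun=> R)) => k W oW.
rewrite -{1}curve_tail0 => W0.
have /(_ W) := @continuous_horner R (\poly_(i < (d - j).+1) F (i + j)%N k) 0.
have V0 : (fun t : R => t^-1) @ +oo --> (0 : R).
  by apply/(@gtr0_cvgV0 R R _ _ id) => //; exact: nbhs_pinfty_gt.
by move=> /(_ (open_nbhs_nbhs (conj oW W0))) /V0.
Qed.

End ScaledCurve.

Lemma exprn_cvgy (R : realType) m : (0 < m)%N -> (fun t : R => t ^+ m) @ +oo --> +oo.
Proof.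
move=> m0; apply/cvgryPge => M; near=> t; rewrite (@le_trans _ _ t) //.
by case: m m0 => // m _; rewrite exprS ler_peMr // exprn_ege1.
Unshelve. all: end_near. Qed.

(** * The Karpelevich polyhedron as the union of the strata *)

Section KarpStrata.
Variables (R : realType) (I : finType).
Implicit Types (A : leveled_tree_partition I) (a b : setpart I)
  (y : Karp_ambient R I).

Lemma in_stratum_Karp A y : in_stratum A y -> Karp R I y.
Proof.
move=> [yInf [g yFin]]; set d := depth A in yInf yFin.
have /boolp.choice[F FP] : forall j, exists F : I -> R,
    (j = d -> F = g) /\ ((j < d)%N -> layer (level A j) (level A j.+1) F /\
    forall b, refines b (level A j) -> ~~ refines b (level A j.+1) ->
      exists2 s, y b = Inf s & sval s = open_ray (\pi_(Xi R b) F)).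
  move=> j; have [jd|dj] := ltnP j d; last by exists g.
  have [F FP] := yInf j jd; exists F; split=> [jE|_]; last exact: FP.
  by rewrite jE ltnn in jd.
(* [F i] is constant on the blocks of level [i.+1], hence on those of any [b] refining a later
   level; these are the terms that cancel in the curve. *)
have Fconst b j i k l : (i < j <= d)%N -> refines b (level A j) ->
    same_block b k l -> F i k = F i l.
  move=> /andP[ij jd] /refinesP bj /bj kl; have id := leq_trans ij jd.
  have lij : refines (level A j) (level A i.+1) by apply: level_mono; rewrite ij.
  have := refinesP lij _ _ kl; have [_ /(_ id)[-> _]] := FP i.
  by move=> /andP[_ /eqP].
have curveE b j t : (j <= d)%N -> refines b (level A j) -> 0 < t ->
    \pi_(Xi R b) (scaled_curve d F t) =
    t ^+ (d - j) *: \pi_(Xi R b) (curve_tail d F j t^-1).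
  move=> jd bj t0; rewrite -Xi_piZ; apply/Xi_eqP => k l kl.
  rewrite (scaled_curve_tail jd) ?gt_eqF // => [|i ij].
    by rewrite mulrBr.
  by apply: (Fconst b j) => //; rewrite ij.
suff cvg_y : (fun t => Karp_diag (\pi_(Xi1 R I) (scaled_curve d F t))) @ +oo --> y.
  move=> U yU; have /filter_ex[t Ut] : \forall t \near +oo,
      U (Karp_diag (\pi_(Xi1 R I) (scaled_curve d F t))) by exact: cvg_y.
  by exists (Karp_diag (\pi_(Xi1 R I) (scaled_curve d F t))); split=> //; eexists.
apply: cvg_prod_topology => b W oW Wy.
suff : \forall t \near +oo, W (Fin (\pi_(Xi R b) (scaled_curve d F t))).
  by apply: filterS => t; rewrite -Karp_diag_pi.
have tpos : \forall t \near +oo, (0 : R) < t by exact: nbhs_pinfty_gt.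
have [bd|[j [jd rb nrb]]] := level_exists A b.
  apply: filterS tpos => t t0; rewrite (curveE b d) // subnn expr0 scale1r.
  rewrite (_ : curve_tail d F d t^-1 = g) -?yFin //.
  apply: funext => k; rewrite /curve_tail subnn horner_poly big_ord1 expr0 mulr1.
  by have [-> ] := FP d.
have [_ /(_ jd)[lF /(_ b rb nrb)[s ys sE]]] := FP j.
rewrite ys in Wy; have sF : sval s (\pi_(Xi R b) (F j)).
  by rewrite sE; exact: open_ray_self.
(* Openness at a ray asks for directions tending to [F j] and scales tending to infinity; the scale
   is [t ^+ (d - j)], with positive exponent because [j < d]. *)
have [+ _] := oW.2 s _ Wy sF.
have w_cvg :
    (fun t => \pi_(Xi R b) (curve_tail d F j t^-1)) @ +oo --> \pi_(Xi R b) (F j).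
  exact: (cvg_comp _ _ (@curve_tail_cvg R I d F j) (@pi_Xi_continuous R I b (F j))).
have t_cvg : (fun t : R => t ^+ (d - j)) @ +oo --> +oo.
  by apply: exprn_cvgy; rewrite subn_gt0.
move=> /(cvg_pair w_cvg t_cvg); apply: filterS2 tpos => t t0 /=.
by rewrite (curveE b j) // ltnW.
Qed.

(** Each split into level sets strictly lowers the number of pairs lying in a common block, so the
    process stops. The start [a] is arbitrary to allow induction. *)
Lemma Karp_chain y a : Karp R I y -> exists s : seq (setpart I),
  [/\ path [rel a b : setpart I | refines b a && (b != a)] a s,
    forall e j, (j < size s)%N -> exists F : I -> R,
      layer (nth e (a :: s) j) (nth e (a :: s) j.+1) F /\
      exists2 r, y (nth e (a :: s) j) = Inf r &
        sval r = open_ray (\pi_(Xi R (nth e (a :: s) j)) F) &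
    exists x, y (last a s) = Fin x].
Proof.
move=> Ky.
have [m] := ubnP #|[set p : I * I | same_block a p.1 p.2]%SET|.
elim: m a => // m IH a; rewrite ltnS => am.
case ya: (y a) => [x|r]; first by exists [::]; split=> //; exists x.
have [v v0 rv] := ray_gen r.
pose F := repr v; have FE : \pi_(Xi R a) F = v by rewrite reprK.
have [|a' a'E] := @setpart_of_equivalence I
    (fun i k => same_block a i k && (F i == F k)).
  move=> i k l; split=> [|/andP[ik /eqP ->]]; first by rewrite same_block_refl eqxx.
  by rewrite (same_block_eqv a i k l).2.
have lF : layer a a' F := a'E.
have a'a := layer_refines lF.
(* The ray has a nonzero generator, so [F] is nonconstant on some block of [a] and the split is
   proper. *)
have ne : ~~ refines a a'.
  apply: contra v0 => /refinesP aa'; rewrite -FE; apply/eqP/Xi_pi_eq0 => i k /aa'.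
  by rewrite lF => /andP[_ /eqP].
have [|s [sp sl sx]] := IH a'.
  apply: leq_trans am; apply: proper_card; apply/properP; split.
    by apply/fintype.subsetP => -[i k]; rewrite !inE /=; exact: (refinesP a'a).
  apply: contrapT => nex; case/negP: ne; apply/refinesP => i k ik.
  by apply: contrapT => /negP nik; apply: nex; exists (i, k); rewrite inE.
exists (a' :: s); split=> //=.
  by rewrite a'a sp andbT; apply: contraNneq ne => ->; rewrite refines_refl.
move=> e [_|j js]; last exact: sl.
by exists F; split=> //; exists r; rewrite // FE.
Qed.

Lemma Karp_in_stratum y : (0 < #|I|)%N -> Karp R I y -> exists A, in_stratum A y.
Proof.
move=> I0 Ky.
have topP : finset.partition [set [set: I]]%SET [set: I].
  apply/and3P; split; first by rewrite /finset.cover big_set1.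
    exact: finset.trivIset1.
  (* Nonemptiness of [I] enters here: the empty set cannot be a block. *)
  by rewrite inE eq_sym -card_gt0 cardsT.
have [s [sp sl [x yx]]] := Karp_chain (SetPart topP) Ky.
have AP : (SetPart topP == [set [set: I]]%SET :> {set {set I}}) &&
    path [rel a b : setpart I | refines b a && (b != a)] (SetPart topP) s.
  by rewrite eqxx.
pose A : leveled_tree_partition I := exist _ (SetPart topP, s) AP.
exists A; split=> [j jA|].
  have [F [lF [r yr rE]]] := sl (SetPart topP) j jA.
  exists F; split=> // b rb nrb.
  (* The chain only prescribes the components at the levels; membership in the closure extends this
     to every [b]. *)
  exact: (Karp_Inf rb Ky yr rE (layer_Xi_neq0 lF rb nrb)).
exists (repr x) => b.
have -> : level A (depth A) = last (SetPart topP) s by rewrite (last_nth (SetPart topP)).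
by move=> rb; rewrite (Karp_Fin rb Ky yx).
Qed.

End KarpStrata.

Theorem mainTheorem4 (R : realType) (n : nat) (hn : (1 <= n)%N) :
  [/\ forall A : leveled_tree_partition 'I_n,
        injective (str_iota A : Str R A -> Karp_ambient R 'I_n),
      trivIset [set: leveled_tree_partition 'I_n]
        (fun A => range (str_iota A : Str R A -> Karp_ambient R 'I_n)) &
      \bigcup_(A in [set: leveled_tree_partition 'I_n])
        range (str_iota A : Str R A -> Karp_ambient R 'I_n)
      = Karp R 'I_n].
Proof.
split=> [A|A B _ _ []|].
- exact: str_iota_inj.
(* [trivIset] asks that two images sharing a point have the same index, which is the uniqueness of
   the stratum through that point. *)
- by move=> y []; rewrite !range_str_iota; exact: in_stratum_uniq.
apply/seteqP; split=> [y [A _]|y /Karp_in_stratum[]].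
- by rewrite range_str_iota; exact: in_stratum_Karp.
- by rewrite card_ord.
by move=> A yA; exists A => //; rewrite range_str_iota.
Qed.
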